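(* Let $n\ge2$. There is a constant $C>0$ depending only on $n$ such that for every locally finite Borel measure $\mu$ on $\mathbb{R}^n$ and every ($\mu$-measurable) set $\Omega\subseteq\mathbb{R}^n$, $$\mu(\Omega)\le C\,\mathrm{Cap}(\Omega,\mathrm{M}_1\mu).$$
   Context: A locally finite Borel measure on $\mathbb{R}^n$ is a positive Borel measure $\mu$ with $\mu(K)<\infty$ for every compact $K$. $\mathcal{L}$ denotes Lebesgue measure, and $\mathrm{M}_1\mu(x)=\sup_{r>0} r\,\mu(B_r(x))/\mathcal{L}(B_r(x))\in[0,\infty]$. For a weight $w$ and $E\subseteq\mathbb{R}^n$, the $\mathrm{BV}(w)$-capacity is $$\mathrm{Cap}(E,w):=\inf\Big\{\int_{\mathbb{R}^n}|\nabla u|\,w\,dx:\ u\in C_c^\infty(\mathbb{R}^n),\ u\ge0,\ u\ge1\text{ in a neighborhood of }E\Big\},$$ with $\inf\emptyset=+\infty$ and $0\cdot\infty=0$ in integrals. *)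

(* Defs.v *)
From HB Require Import structures.
From mathcomp Require Import all_boot all_order all_algebra.
From mathcomp Require Import lra.
From mathcomp Require Import all_classical all_reals all_analysis.

Set Implicit Arguments.
Unset Strict Implicit.
Unset Printing Implicit Defensive.

Import Order.TTheory GRing.Theory Num.Theory.
Import numFieldNormedType.Exports.

Local Open Scope classical_set_scope.
Local Open Scope ring_scope.

(* R^n is 'rV[R]_n.  The norm that the library puts on it is the sup norm, which
   has the Euclidean topology; Euclidean lengths and balls are enorm and eball.
   borel_rV is the same carrier with the Borel sigma-algebra. *)
Notation borel_rV R n := (g_sigma_algebraType (@open 'rV[R]_n)).

Section lebesgue_rV.
Context {R : realType}.

Definition cons_rV {n} (p : R * 'rV[R]_n) : 'rV[R]_n.+1 :=
  row_mx (const_mx p.1 : 'rV[R]_1) p.2.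

Definition uncons_rV {n} (v : 'rV[R]_n.+1) : R * 'rV[R]_n :=
  (v 0 0, \row_j v 0 (lift 0 j)).

Lemma cons_rV0 n (p : R * 'rV[R]_n) : cons_rV p 0 0 = p.1.
Proof.
have -> : (0 : 'I_n.+1) = lshift n (0 : 'I_1) by exact/val_inj.
by rewrite /cons_rV (row_mxEl (const_mx p.1 : 'rV[R]_1)) mxE.
Qed.

Lemma cons_rVS n (p : R * 'rV[R]_n) j : cons_rV p 0 (lift 0 j) = p.2 0 j.
Proof.
have -> : lift (0 : 'I_n.+1) j = rshift 1 j by exact/val_inj.
by rewrite /cons_rV (row_mxEr (const_mx p.1 : 'rV[R]_1)).
Qed.

Lemma cons_rVK n : cancel (@cons_rV n) uncons_rV.
Proof.
move=> p; rewrite /uncons_rV cons_rV0 [RHS]surjective_pairing; congr pair.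
by apply/rowP => j; rewrite mxE cons_rVS.
Qed.

Lemma measurable_fun_into_borel_rV d (T : measurableType d) n
    (f : T -> borel_rV R n) :
  (forall U : set 'rV[R]_n, open U -> measurable (f @^-1` U)) ->
  measurable_fun setT f.
Proof.
move=> mf; apply: (@measurability _ _ T (borel_rV R n) setT f (@open 'rV[R]_n)) => //.
by move=> _ [U oU <-]; rewrite setTI; exact: mf.
Qed.

Lemma rat_approx (x e : R) : 0 < e -> exists q : rat, ball (ratr q : R) e x.
Proof.
move=> e0; have : x - e < x + e by lra.
move=> /rat_in_itvoo[q]; rewrite in_itv/= => /andP[q1 q2]; exists q.
by rewrite /ball/= ltr_norml; apply/andP; split; lra.
Qed.

Lemma measurable_cons_rV n :
  measurable_fun [set: measurableTypeR R * borel_rV R n]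
    (@cons_rV n : _ -> borel_rV R n.+1).
Proof.
apply: measurable_fun_into_borel_rV => U oU.
pose box (k : rat * 'rV[rat]_n * rat) : set (R * 'rV[R]_n) :=
  ball (ratr k.1.1 : R) (ratr k.2 : R) `*`
  ball (map_mx ratr k.1.2 : 'rV[R]_n) (ratr k.2 : R).
have mbox k : @measurable _ (measurableTypeR R * borel_rV R n)%type (box k).
  apply: measurableX.
    by apply: measurable_realfun.open_measurable; exact: ball_open.
  by apply: sub_sigma_algebra; exact: ball_open.
pose inU k : bool := `[< box k `<=` @cons_rV n @^-1` U >].
rewrite [X in measurable X](_ : _ = \bigcup_k if inU k then box k else set0);
    last first.
  apply/seteqP; split => [p Up|p [k _]]; last first.
    by case: ifPn => // /asboolP; exact.
  have /nbhs_ballP[e /= e0 eU] : nbhs (cons_rV p) U by exact: open_nbhs_nbhs.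
  have /rat_in_itvoo[r] : 0 < e / 2 by rewrite divr_gt0.
  rewrite in_itv/= => /andP[r0 re].
  have [q qp] := rat_approx p.1 r0.
  have /choice[v vp] : forall j, exists q : rat, ball (ratr q : R) (ratr r) (p.2 0 j).
    by move=> j; exact: rat_approx.
  have pbox : box (q, \row_j v j, r) p.
    split=> //=; split=> //= i j; rewrite ord1 !mxE; exact: vp.
  exists (q, \row_j v j, r) => //.
  rewrite ifT//; apply/asboolP => p' [/= p1 [_ p2]]; apply: eU.
  have close (a x y : R) : ball a (ratr r) x -> ball a (ratr r) y -> ball x e y.
    by move=> /ball_sym ax ay; apply: (le_ball _ (ball_triangle ax ay)); lra.
  split=> // i j; rewrite ord1; case: (unliftP 0 j) => [k ->|->].
    rewrite !cons_rVS; apply: (close (ratr (v k))); first exact: vp.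
    by have := p2 0 k; rewrite !mxE.
  by rewrite !cons_rV0; exact: (close (ratr q)).
apply: countable_bigcupT_measurable; first exact: countableP.
by move=> k; case: ifP => // _; exact: mbox.
Qed.

Lemma measurable_uncons_rV n :
  measurable_fun [set: borel_rV R n.+1]
    (@uncons_rV n : _ -> measurableTypeR R * borel_rV R n).
Proof.
apply: measurable_fun_pair.
  apply: (measurability (@measurable_realfun.RGenOpens.G R)).
    exact: measurable_realfun.RGenOpens.measurableE.
  move=> _ [_ [a [b ->]] <-]; rewrite setTI; apply: sub_sigma_algebra.
  by apply: open_comp => // v _; exact: coord_continuous.
apply: measurable_fun_into_borel_rV => U oU; apply: sub_sigma_algebra.
apply: open_comp => // v _ A /nbhs_ballP[e /= e0 eA].
apply/nbhs_ballP; exists e => //= w vw; apply: eA; split=> // i j.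
by rewrite ord1 !mxE; exact: vw.2.
Qed.

Section push_cons.
Variables (n : nat) (m : {sigma_finite_measure set (borel_rV R n) -> \bar R}).

Definition push_cons : set (borel_rV R n.+1) -> \bar R :=
  pushforward (lebesgue_measure \x m)%E (@cons_rV n : _ -> borel_rV R n.+1).

Let push_cons0 : push_cons set0 = 0%E.
Proof. by rewrite /push_cons measure0//; exact: measurable_cons_rV. Qed.

Let push_cons_ge0 A : (0 <= push_cons A)%E.
Proof. by apply: measure_ge0; exact: measurable_cons_rV. Qed.

Let push_cons_sigma_additive : semi_sigma_additive push_cons.
Proof. by apply: measure_semi_sigma_additive; exact: measurable_cons_rV. Qed.

HB.instance Definition _ := isMeasure.Build _ _ _ push_cons
  push_cons0 push_cons_ge0 push_cons_sigma_additive.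

Let push_cons_sigma_finite : sigma_finite setT push_cons.
Proof.
have /sigma_finiteP[F [TF ndF Foo]] := sigma_finiteT (@lebesgue_measure R).
have /sigma_finiteP[G [TG ndG Goo]] := sigma_finiteT m.
exists (fun k => @uncons_rV n @^-1` (F k `*` G k)).
  rewrite -preimage_bigcup; apply/esym; rewrite -subTset => v _ /=.
  have [i _ Fi] : (\bigcup_k F k) (uncons_rV v).1 by rewrite -TF.
  have [j _ Gj] : (\bigcup_k G k) (uncons_rV v).2 by rewrite -TG.
  exists (maxn i j) => //; split.
  - by move: Fi; exact/subsetPset/ndF/leq_maxl.
  - by move: Gj; exact/subsetPset/ndG/leq_maxr.
move=> k; have [mF Fk] := Foo k; have [mG Gk] := Goo k; split.
  rewrite -[X in measurable X]setTI; apply: measurable_uncons_rV => //.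
  exact: measurableX.
rewrite /push_cons /pushforward -comp_preimage.
rewrite (_ : _ \o _ = id); last by apply/funext => p /=; rewrite cons_rVK.
by rewrite preimage_id product_measure1E// lte_mul_pinfty// ge0_fin_numE.
Qed.

HB.instance Definition _ := Measure_isSigmaFinite.Build _ _ _ push_cons
  push_cons_sigma_finite.

End push_cons.

(* The n-fold product of Lebesgue measure on R, transported to 'rV[R]_n along
   cons_rV; on R^0 it is the unit mass at the only point. *)
Fixpoint lebesgue_rV n : {sigma_finite_measure set (borel_rV R n) -> \bar R} :=
  if n is n'.+1 then push_cons (lebesgue_rV n') else dirac (0 : borel_rV R 0).

End lebesgue_rV.
Arguments lebesgue_rV : clear implicits.

Section capacity.
Context {R : realType} {n : nat}.

Definition enorm (v : 'rV[R]_n) : R := Num.sqrt (\sum_i v 0 i ^+ 2).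

Definition eball (x : 'rV[R]_n) (r : R) : set 'rV[R]_n :=
  [set y | enorm (y - x) < r].

Definition partial (i : 'I_n) (u : 'rV[R]_n -> R) : 'rV[R]_n -> R :=
  'D_(delta_mx 0 i) u.

Definition iter_partial (s : seq 'I_n) (u : 'rV[R]_n -> R) : 'rV[R]_n -> R :=
  foldr partial u s.

Definition grad (u : 'rV[R]_n -> R) (x : 'rV[R]_n) : 'rV[R]_n :=
  \row_i partial i u x.

(* 'D_v is total, so the existence of each partial derivative is required
   separately. *)
Definition smooth (u : 'rV[R]_n -> R) : Prop :=
  forall s : seq 'I_n, continuous (iter_partial s u) /\
    forall i x, derivable (iter_partial s u) x (delta_mx 0 i).

Definition compactly_supported (u : 'rV[R]_n -> R) : Prop :=
  compact (closure [set x | u x != 0]).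

Definition locally_finite (mu : {measure set (borel_rV R n) -> \bar R}) : Prop :=
  forall K : set 'rV[R]_n, compact K -> (mu K < +oo)%E.

Local Open Scope ereal_scope.

Definition maximal1 (mu : {measure set (borel_rV R n) -> \bar R})
    (x : 'rV[R]_n) : \bar R :=
  ereal_sup [set r%:E * mu (eball x r) / lebesgue_rV R n (eball x r) |
             r in [set r : R | (0 < r)%R]].

Definition cap_admissible (E : set 'rV[R]_n) : set ('rV[R]_n -> R) :=
  [set u | [/\ smooth u, compactly_supported u, forall x, (0 <= u x)%R &
    exists V, [/\ open V, E `<=` V & forall x, V x -> (1 <= u x)%R]]].

(* As ereal_inf set0 = +oo and 0 * +oo = 0 in \bar R, no side condition is
   needed. *)
Definition BVcap (E : set 'rV[R]_n) (w : 'rV[R]_n -> \bar R) : \bar R :=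
  ereal_inf [set \int[lebesgue_rV R n]_x ((enorm (grad u x))%:E * w x) |
             u in cap_admissible E].

End capacity.

(* Main.v *)
Require Import Defs.
From HB Require Import structures.
From mathcomp Require Import all_boot all_order all_algebra.
From mathcomp Require Import ring lra.
From mathcomp Require Import all_classical all_reals all_analysis.
From mathcomp Require Import measurable_realfun.

(* Let u be admissible.  By pigeonhole, some thin layer {t < u < t + h} below
   level 1/2 carries both little volume and at most its fair share, of order h,
   of the energy int |grad u| M_1 mu; composing u with a smooth step across that
   layer gives a function v which is almost an indicator and whose weighted
   energy is controlled by that of u (this replaces the coarea formula).  A
   dyadic stopping time then selects disjoint cubes Q covering {u >= 1} on which
   {v = 1} and {v = 0} both have volume comparable to |Q|.  The L^1 Poincare
   inequality gives side(Q)^(n-1) <= C int_Q |grad v|, while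
   mu(Q) <= C side(Q)^(n-1) M_1 mu pointwise on Q; multiplying and summing over Q
   bounds mu {u >= 1}. *)

Set Implicit Arguments.
Unset Strict Implicit.
Unset Printing Implicit Defensive.

Import Order.TTheory GRing.Theory Num.Theory.
Import numFieldNormedType.Exports.

Local Open Scope classical_set_scope.
Local Open Scope ring_scope.

(** * Fubini on half-open cubes *)

Section cube.
Context {R : realType}.

(** Half-open, so that the dyadic children of a cube partition it exactly, with no faces to
    discard. *)
Definition cube n (a : 'rV[R]_n) (l : R) : set 'rV[R]_n :=
  [set x | forall i, a 0 i <= x 0 i < a 0 i + l].

Definition tail_rV n (a : 'rV[R]_n.+1) : 'rV[R]_n := (uncons_rV a).2.

Lemma tail_cons n (p : R * 'rV[R]_n) : tail_rV (cons_rV p) = p.2.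
Proof. by rewrite /tail_rV cons_rVK. Qed.

Lemma continuous_measurable_rV n (f : 'rV[R]_n -> R) :
  continuous f ->
  measurable_fun [set: borel_rV R n] (f : borel_rV R n -> measurableTypeR R).
Proof.
move=> cf; apply: (measurability (@measurable_realfun.RGenOpens.G R)).
  exact: measurable_realfun.RGenOpens.measurableE.
move=> _ [_ [a [b ->]] <-]; rewrite setTI; apply: sub_sigma_algebra.
by apply: open_comp => // v _; exact: cf.
Qed.

Lemma continuous_measurable_rVE n (f : 'rV[R]_n -> R) :
  continuous f -> measurable_fun [set: borel_rV R n] (fun x => (f x)%:E).
Proof.
by move=> cf; apply/measurable_EFinP; exact: continuous_measurable_rV.
Qed.

Lemma measurable_cube n (a : 'rV[R]_n) l :
  measurable (cube a l : set (borel_rV R n)).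
Proof.
rewrite [X in measurable X](_ : _ = \bigcap_(i in [set: 'I_n])
  ((fun x : borel_rV R n => x 0 i : measurableTypeR R) @^-1`
      `[a 0 i, a 0 i + l[)); last first.
  apply/seteqP; split => x /= xa i.
    by move=> _ /=; rewrite in_itv/= xa.
  by have := xa i I; rewrite /= in_itv.
apply: fin_bigcap_measurable => // i _; rewrite -[X in measurable X]setTI.
apply: continuous_measurable_rV => //; exact: coord_continuous.
Qed.

Lemma cons_cube n (a : 'rV[R]_n.+1) l :
  @cons_rV R n @^-1` cube a l = `[a 0 0, a 0 0 + l[ `*` cube (tail_rV a) l.
Proof.
apply/seteqP; split => [p /= h|p /= [h0 h] i].
  split=> [|i]; first by have := h 0; rewrite cons_rV0 in_itv.
  by have := h (lift 0 i); rewrite cons_rVS mxE.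
case: (unliftP 0 i) => [j|] ->; last by rewrite cons_rV0; rewrite in_itv in h0.
by rewrite cons_rVS; have := h j; rewrite mxE.
Qed.

Lemma lebesgue_cube n (a : 'rV[R]_n) l : 0 <= l ->
  lebesgue_rV R n (cube a l) = (l ^+ n)%:E.
Proof.
move=> l0; elim: n a => [|n IH] a.
  by rewrite /= diracE mem_set// => -[].
(* By conversion: in dimension [n.+1] the measure is by construction the pushforward along [cons_rV]
   of the product measure. *)
have -> : lebesgue_rV R n.+1 (cube a l) =
    (lebesgue_measure \x lebesgue_rV R n)%E (@cons_rV R n @^-1` cube a l).
  by [].
rewrite cons_cube product_measure1E//; last exact: measurable_cube.
rewrite IH exprS EFinM; congr (_ * _)%E.
have := lebesgue_measure_itv `[a 0 0, a 0 0 + l[; rewrite /= lte_fin ltrDl.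
case: ltgtP l0 => // [l0 _ ->|<- _ ->//].
by rewrite -EFinD addrAC subrr add0r.
Qed.

Section fubini.
Variables (n : nat) (a : 'rV[R]_n.+1) (l : R) (f : borel_rV R n.+1 -> \bar R).
Hypothesis mf : measurable_fun setT f.
Hypothesis f0 : forall x, (0 <= f x)%E.

Let I : set (measurableTypeR R) := `[a 0 0, a 0 0 + l[%classic.
Let Q : set (borel_rV R n) := cube (tail_rV a) l.
(** Cutting [f] off to the cube before pulling it back makes Tonelli apply on the whole product;
    what remains is to recognize the restrictions in each variable. *)
Let F (p : measurableTypeR R * borel_rV R n) := ((f \_ (cube a l)) (cons_rV p))%E.

Let mfQ : measurable_fun setT
  (f \_ (cube a l) : borel_rV R n.+1 -> \bar R).
Proof.
apply/(measurable_restrictT _ _).1; first exact: measurable_cube.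
exact: measurable_funTS.
Qed.

Let mF : measurable_fun setT F.
Proof. exact: (measurableT_comp mfQ (@measurable_cons_rV R n)). Qed.

Let F0 p : (0 <= F p)%E.
Proof. by rewrite /F patchE; case: ifP. Qed.

Let FE p : F p = if (p.1 \in I) && (p.2 \in Q) then f (cons_rV p) else 0%E.
Proof.
rewrite /F patchE; congr (if _ then _ else _).
have := cons_cube a l => /seteqP[h1 h2].
apply/idP/idP.
  by rewrite inE => /h1[? ?]; apply/andP; split; rewrite inE.
by move=> /andP[]; rewrite !inE => ? ?; apply: h2.
Qed.

Let integral_F : (\int[lebesgue_rV R n.+1]_(x in cube a l) f x =
  \int[lebesgue_measure \x lebesgue_rV R n]_p F p)%E.
Proof.
rewrite integral_mkcond.
rewrite (@ge0_integral_pushforward _ _ _ _ _ _ (@measurable_cons_rV R n)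
  (lebesgue_measure \x lebesgue_rV R n)%E setT)//.
by move=> x _; rewrite patchE; case: ifP.
Qed.

Let FE1 s : (\int[lebesgue_rV R n]_y F (s, y))%E =
  ((fun s => \int[lebesgue_rV R n]_(y in Q) f (cons_rV (s, y))) \_ I)%E s.
Proof.
rewrite patchE; case: ifP => sI.
  rewrite [RHS]integral_mkcond; apply: eq_integral => y _.
  by rewrite FE patchE/= sI.
by rewrite integral0_eq// => y _; rewrite FE/= sI.
Qed.

Let FE2 y : (\int[lebesgue_measure]_s F (s, y))%E =
  ((fun y => \int[lebesgue_measure]_(s in I) f (cons_rV (s, y))) \_ Q)%E y.
Proof.
rewrite patchE; case: ifP => sI.
  rewrite [RHS]integral_mkcond; apply: eq_integral => s _.
  by rewrite FE patchE/= sI andbT.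
by rewrite integral0_eq// => s _; rewrite FE/= sI andbF.
Qed.

(** The first coordinate is outermost: this order locates a good slice in the Poincare
    inequality. *)
Lemma integral_cube1 : (\int[lebesgue_rV R n.+1]_(x in cube a l) f x =
  \int[lebesgue_measure]_(s in I)
    \int[lebesgue_rV R n]_(y in Q) f (cons_rV (s, y)))%E.
Proof.
rewrite integral_F fubini_tonelli1// [RHS]integral_mkcond.
by apply: eq_integral => s _; exact: FE1.
Qed.

(** The opposite order reassembles integrals along lines in the first direction into an integral
    over the cube. *)
Lemma integral_cube2 : (\int[lebesgue_rV R n.+1]_(x in cube a l) f x =
  \int[lebesgue_rV R n]_(y in Q)
    \int[lebesgue_measure]_(s in I) f (cons_rV (s, y)))%E.
Proof.
rewrite integral_F fubini_tonelli2// [RHS]integral_mkcond.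
by apply: eq_integral => s _; exact: FE2.
Qed.

Lemma measurable_integral_cube1 : measurable_fun I
  (fun s => \int[lebesgue_rV R n]_(y in Q) f (cons_rV (s, y)))%E.
Proof.
apply/(measurable_restrictT _ _).2; first exact: measurable_itv.
set G := (X in measurable_fun _ X).
have -> : G = fubini_F (lebesgue_rV R n) F by apply/funext => z; exact/esym/FE1.
exact: measurable_fun_fubini_tonelli_F.
Qed.

Lemma measurable_integral_cube2 : measurable_fun Q
  (fun y => \int[lebesgue_measure]_(s in I) f (cons_rV (s, y)))%E.
Proof.
apply/(measurable_restrictT _ _).2 => //; first exact: measurable_cube.
set G := (X in measurable_fun _ X).
have -> : G = fubini_G (lebesgue_measure) F by apply/funext => z; exact/esym/FE2.
exact: measurable_fun_fubini_tonelli_G.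
Qed.

End fubini.

End cube.

(** * The Poincare inequality on cubes *)

Section poincare.
Context {R : realType}.

Definition upd n (x : 'rV[R]_n) (i : 'I_n) (t : R) : 'rV[R]_n :=
  \row_j if j == i then t else x 0 j.

Lemma upd_id n (x : 'rV[R]_n) i : upd x i (x 0 i) = x.
Proof. by apply/rowP => j; rewrite mxE; case: eqP => // ->. Qed.

Lemma upd0 n (x : 'rV[R]_n.+1) t : upd x 0 t = cons_rV (t, tail_rV x).
Proof.
apply/rowP => i; case: (unliftP 0 i) => [j|] ->; rewrite mxE.
  by rewrite cons_rVS mxE.
by rewrite cons_rV0.
Qed.

(** Coordinate lines inside a slice are coordinate lines of the whole space, so the line hypothesis
    of the Poincare inequality passes to slices. *)
Lemma updS n s (y : 'rV[R]_n) i t :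
  cons_rV (s, upd y i t) = upd (cons_rV (s, y)) (lift 0 i) t.
Proof.
apply/rowP => k; case: (unliftP 0 k) => [j|] ->; rewrite [RHS]mxE.
  by rewrite !cons_rVS mxE (inj_eq lift_inj).
by rewrite !cons_rV0.
Qed.

Lemma continuous_consr n (s : R) : continuous (fun y : 'rV[R]_n => cons_rV (s, y)).
Proof.
move=> y A /nbhs_ballP[e /= e0 eA].
apply/nbhs_ballP; exists e => //= z [_ yz]; apply: eA; split=> // i j.
rewrite ord1; case: (unliftP 0 j) => [k|] ->.
  by rewrite !cons_rVS; exact: yz.
by rewrite !cons_rV0; exact: ballxx.
Qed.

Lemma measurable_tail_rV n :
  measurable_fun [set: borel_rV R n.+1] (@tail_rV R n : _ -> borel_rV R n).
Proof. exact: measurableT_comp measurable_snd (@measurable_uncons_rV R n). Qed.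

Lemma continuous_normB n (v : 'rV[R]_n -> R) c :
  continuous v -> continuous (fun x => `|v x - c|).
Proof.
move=> cv x.
apply: (@continuous_comp _ _ _ (fun x => v x - c) Num.norm).
  by apply: continuousB; [exact: cv|exact: cst_continuous].
exact: norm_continuous.
Qed.

Lemma integral_cst_itvco (b l : R) (k : \bar R) : 0 <= l ->
  (\int[lebesgue_measure]_(s in `[b, (b + l)%R[) k = k * l%:E)%E.
Proof.
move=> l0; rewrite integral_cst; last exact: measurable_itv.
congr (_ * _)%E.
have := lebesgue_measure_itv `[b, b + l[; rewrite /= lte_fin ltrDl.
case: ltgtP l0 => // [l0 _ ->|<- _ ->//].
by rewrite -EFinD addrAC subrr add0r.
Qed.

Lemma integral_cube_tail n (a : 'rV[R]_n.+1) l (h : borel_rV R n -> \bar R) :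
  0 <= l -> measurable_fun setT h -> (forall y, 0 <= h y)%E ->
  (\int[lebesgue_rV R n.+1]_(x in cube a l) h (tail_rV x) =
   l%:E * \int[lebesgue_rV R n]_(y in cube (tail_rV a) l) h y)%E.
Proof.
move=> l0 mh h0; rewrite integral_cube1//; last first.
  exact: measurableT_comp mh (@measurable_tail_rV n).
under eq_integral => s _ do under eq_integral => y _ do rewrite tail_cons/=.
by rewrite integral_cst_itvco// muleC.
Qed.

(* [upd x i] runs along the coordinate line through [x]: only increments of [v]
   along such lines enter, so [g] plays the role of the length of the gradient.
   The constant [c] comes from a slice on which the integral of [g] is at most
   average, by induction on the dimension. *)
Lemma poincare_cube n (a : 'rV[R]_n) l (v g : 'rV[R]_n -> R) (K : R) :
  0 < l -> continuous v -> continuous g -> (forall x, 0 <= g x) ->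
  (forall x i s t, a 0 i <= s < a 0 i + l -> a 0 i <= t < a 0 i + l ->
    (`|v (upd x i s) - v (upd x i t)|%R%:E <=
     \int[lebesgue_measure]_(r in `[a 0%R i, (a 0%R i + l)%R[) (g (upd x i r))%:E)%E) ->
  (\int[lebesgue_rV R n]_(x in cube a l) (g x)%:E < K%:E)%E ->
  exists c, (\int[lebesgue_rV R n]_(x in cube a l) `|v x - c|%R%:E <=
             (n%:R * l * K)%:E)%E.
Proof.
move=> l0; elim: n a v g K => [|n IH] a v g K cv cg g0 vg gK.
  exists (v 0); rewrite integral0_eq ?mul0r// => x _.
  by rewrite (_ : x = 0) ?subrr ?normr0//; apply/rowP => -[].
set I : set (measurableTypeR R) := `[a 0 0, a 0 0 + l[%classic.
have mI : measurable I by exact: measurable_itv.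
set Q : set (borel_rV R n) := cube (tail_rV a) l.
have mQ : measurable Q by exact: measurable_cube.
have mg := continuous_measurable_rVE cg.
have g0E x : (0 <= (g x)%:E)%E by rewrite lee_fin.
(* If every slice carried at least [K / l], integrating over an interval of length [l] would give at
   least [K]. As the bound [K] is strict, monotonicity of the integral suffices. *)
have [s0 /= s0I gs0] : exists2 s0, I s0 &
    (\int[lebesgue_rV R n]_(y in Q) (g (cons_rV (s0, y)))%:E < (K / l)%:E)%E.
  apply: contrapT => /forall2NP h; move: (gK); apply/negP; rewrite -leNgt.
  rewrite (integral_cube1 a l mg g0E).
  rewrite [leLHS](_ : _ = \int[lebesgue_measure]_(s in I) (K / l)%:E)%E; last first.
    by rewrite integral_cst_itvco ?ltW// -EFinM divfK// gt_eqF.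
  have K0 : 0 <= K / l.
    apply: divr_ge0 (ltW l0).
    suff : (0 <= K%:E)%E by rewrite lee_fin.
    by apply: le_trans (ltW gK); exact: integral_ge0.
  apply: ge0_le_integral => //.
    exact: measurable_integral_cube1 mg g0E.
  by move=> s sI; have [//|/negP] := h s; rewrite -leNgt.
have [||||c cP] := IH (tail_rV a) (fun y => v (cons_rV (s0, y)))
    (fun y => g (cons_rV (s0, y))) (K / l) _ _ _ _ gs0.
- by move=> y; apply: continuous_comp; [exact: continuous_consr|exact: cv].
- by move=> y; apply: continuous_comp; [exact: continuous_consr|exact: cg].
- by [].
- move=> y i s t; rewrite mxE => sI tI; rewrite !updS.
  under eq_integral do rewrite updS.
  exact: vg.
exists c.
pose h y := (\int[lebesgue_measure]_(s in I) (g (cons_rV (s, y)))%:E)%E.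
pose H := h \_ Q.
have mH : measurable_fun setT (H : borel_rV R n -> _).
  have mh := @measurable_integral_cube2 _ _ a l _ mg g0E.
  exact: ((measurable_restrictT _ mQ).1 mh).
have H0 y : (0 <= H y)%E by rewrite /H patchE; case: ifP => // _; exact: integral_ge0.
pose w y := (`|v (cons_rV (s0, y)) - c|%R%:E)%E.
have mw : measurable_fun setT (w : borel_rV R n -> _).
  apply: continuous_measurable_rVE; apply: continuous_normB => y.
  by apply: continuous_comp; [exact: continuous_consr|exact: cv].
have mHt := measurableT_comp mH (@measurable_tail_rV n).
have mwt := measurableT_comp mw (@measurable_tail_rV n).
have w0 y : (0 <= w y)%E by rewrite lee_fin.
(* Move [x] along the first coordinate to the good slice: the increment of [v] is at most the line
   integral [H], and the remainder [w] lives on the slice, where the induction hypothesis bounds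
   it. *)
apply: (@le_trans _ _ (\int[lebesgue_rV R n.+1]_(x in cube a l)
   (H (tail_rV x) + w (tail_rV x)))%E).
  apply: ge0_le_integral => //.
  - exact: measurable_cube.
  - apply: measurable_funTS; apply: continuous_measurable_rVE.
    exact: continuous_normB.
  - by apply: measurable_funTS; exact: (emeasurable_funD mHt mwt).
  - move=> x xa; rewrite /H patchE mem_set; last first.
      by move=> i; have := xa (lift 0 i); rewrite !mxE.
    apply: (@le_trans _ _ (`|v x - v (cons_rV (s0, tail_rV x))|%R%:E + w (tail_rV x))%E).
      by rewrite /w -EFinD lee_fin; exact: ler_distD.
    rewrite leeD2r//; rewrite -upd0 -{1}(upd_id x 0).
    apply: le_trans (vg _ _ _ _ (xa 0) _) _; first by move: s0I; rewrite /I/= in_itv.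
    by under eq_integral do rewrite upd0.
rewrite ge0_integralD//; last 3 first.
- exact: measurable_cube.
- exact: measurable_funTS mHt.
- exact: measurable_funTS mwt.
rewrite !integral_cube_tail//; try exact: ltW.
have -> : (\int[lebesgue_rV R n]_(y in cube (tail_rV a) l) H y)%E =
    (\int[lebesgue_rV R n.+1]_(x in cube a l) (g x)%:E)%E.
  rewrite (integral_cube2 a l mg g0E); apply: eq_integral => y yQ.
  by rewrite /H patchE yQ.
rewrite -muleDr//; last by rewrite ge0_adde_def// inE integral_ge0.
(* The free first coordinate gives both terms a factor [l]; the slice term adds [n * K] to the [K]
   of the line term, whence [n.+1]. *)
rewrite [leRHS](_ : _ = l%:E * (K + n%:R * l * (K / l))%:E)%E; last first.
  by rewrite -EFinM; congr EFin; field; rewrite gt_eqF.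
apply: lee_wpmul2l; first by rewrite lee_fin ltW.
by rewrite EFinD; apply: leeD cP; exact: ltW.
Qed.

End poincare.

(** * Smooth truncation *)

Section oscillation.
Context {R : realType}.

(** Whatever the constant [c], [|1 - c| + |c| >= 1]; so if [A] and [B] both have volume at least
    [m], the integral of [|v - c|] is at least [m], and the Poincare inequality bounds it from
    above. *)
Lemma poincare_levels n (a : 'rV[R]_n) l (v g : 'rV[R]_n -> R)
    (A B : set (borel_rV R n)) (m : R) :
  (0 < n)%N -> 0 < l -> continuous v -> continuous g -> (forall x, 0 <= g x) ->
  (forall x i s t, a 0 i <= s < a 0 i + l -> a 0 i <= t < a 0 i + l ->
    (`|v (upd x i s) - v (upd x i t)|%R%:E <=
     \int[lebesgue_measure]_(r in `[a 0%R i, (a 0%R i + l)%R[)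
       (g (upd x i r))%:E)%E) ->
  measurable A -> measurable B -> A `<=` cube a l -> B `<=` cube a l ->
  (forall x, A x -> v x = 1) -> (forall x, B x -> v x = 0) ->
  0 <= m -> (m%:E <= lebesgue_rV R n A)%E -> (m%:E <= lebesgue_rV R n B)%E ->
  (m%:E <= (n%:R * l)%:E * \int[lebesgue_rV R n]_(x in cube a l) (g x)%:E)%E.
Proof.
move=> n0 l0 cv cg g0 vg mA mB AQ BQ vA vB m0 LA LB.
have mQ := @measurable_cube R n a l.
have nl0 : 0 < n%:R * l by rewrite mulr_gt0// ltr0n.
have : (0 <= \int[lebesgue_rV R n]_(x in cube a l) (g x)%:E)%E.
  by apply: integral_ge0 => x _; rewrite lee_fin.
case E : (\int[lebesgue_rV R n]_(x in cube a l) (g x)%:E)%E => [G| |]// _; last first.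
  by rewrite gt0_muley ?lte_fin// leey.
(* The Poincare inequality asks for a strict bound on the integral of [g], hence the slack [e],
   rescaled so that it comes out as exactly [e]. *)
apply/lee_addgt0Pr => e e0.
have [|c cP] := @poincare_cube R n a l v g (G + e / (n%:R * l)) l0 cv cg g0 vg.
  by rewrite E lte_fin ltrDl divr_gt0.
rewrite -!EFinM -EFinD.
rewrite [leRHS](_ : _ = (n%:R * l * (G + e / (n%:R * l)))%:E); last first.
  congr EFin; rewrite mulrDr; congr (_ + _).
  by rewrite mulrC divfK// gt_eqF.
apply: le_trans cP.
have mvc : measurable_fun setT (fun x : borel_rV R n => (`|v x - c|%R%:E)).
  by apply: continuous_measurable_rVE; exact: continuous_normB.
have dAB : [disjoint A & B].
  apply/disj_setPS => x [/vA + /vB]; move=> -> /eqP; by rewrite oner_eq0.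
apply: (@le_trans _ _ (\int[lebesgue_rV R n]_(x in A `|` B) `|v x - c|%R%:E)%E); last first.
  apply: ge0_subset_integral => //; first exact: measurableU.
    exact: measurable_funTS.
  by move=> x [/AQ|/BQ].
rewrite ge0_integral_setU//; last exact: measurable_funTS.
rewrite (@eq_integral _ _ _ _ A (cst `|1 - c|%R%:E)); last first.
  by move=> x; rewrite inE => /vA ->.
rewrite (@eq_integral _ _ _ _ B (cst `|c|%R%:E)); last first.
  by move=> x; rewrite inE => /vB ->; rewrite sub0r normrN.
rewrite !integral_cst//.
apply: (@le_trans _ _ ((`|1 - c|%R%:E * m%:E + `|c|%R%:E * m%:E)%E)).
  rewrite -!EFinM -EFinD lee_fin -mulrDl ler_peMl//.
  by rewrite (le_trans _ (ler_normD _ _))// subrK normr1.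
by apply: leeD; apply: lee_wpmul2l.
Qed.

(** The fundamental theorem of calculus on [[s, t]], after which the nonnegative integrand is
    integrated over the whole interval. *)
Lemma increment_le_integral (h dh G : R -> R) (b l s t : R) :
  (forall x : R, is_derive x 1 h (dh x)) -> continuous dh -> continuous G ->
  (forall x, `|dh x| <= G x) ->
  b <= s < b + l -> b <= t < b + l ->
  (`|h s - h t|%R%:E <= \int[lebesgue_measure]_(r in `[b, (b + l)%R[) (G r)%:E)%E.
Proof.
move=> hdh cdh cG dhG; wlog st : s t / s <= t.
  move=> W sb tb; have [/W|/ltW/W] := leP s t; first exact.
  by rewrite distrC; exact.
move=> /andP[bs sl] /andP[bt tl].
have mG : measurable_fun setT (fun r : measurableTypeR R => (G r)%:E).
  by apply/measurable_EFinP; exact: continuous_measurable_fun.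
have G0 x : (0 <= (G x)%:E)%E by rewrite lee_fin (le_trans _ (dhG x)).
move: st; rewrite le_eqVlt => /predU1P[->|st].
  by rewrite subrr normr0 integral_ge0.
have ch : continuous h.
  by move=> x; apply/differentiable_continuous/derivable1_diffP; have [] := hdh x.
have FTC := @continuous_FTC2 R dh h s t st.
rewrite distrC -abse_EFin EFinB -FTC; last 3 first.
- exact: continuous_subspaceT.
- split.
  + by move=> x _; have [] := hdh x.
  + by apply: cvg_at_right_filter; exact: ch.
  + by apply: cvg_at_left_filter; exact: ch.
- by move=> x _; rewrite derive1E; have [_ ->] := hdh x.
have mst : measurable (`[s, t]%classic : set (measurableTypeR R)) by exact: measurable_itv.
have mbl : measurable (`[b, b + l[%classic : set (measurableTypeR R)) by exact: measurable_itv.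
have mdh : measurable_fun setT (fun r : measurableTypeR R => (dh r)%:E).
  by apply/measurable_EFinP; exact: continuous_measurable_fun.
apply: (le_trans (le_abse_integral _ mst (measurable_funTS mdh))).
apply: (@le_trans _ _ (\int[lebesgue_measure]_(r in `[s, t]) (G r)%:E)%E).
  apply: ge0_le_integral => //.
  - by apply: measurableT_comp => //; exact: measurable_funTS.
  - exact: measurable_funTS.
  - by move=> x _; rewrite lee_fin.
apply: ge0_subset_integral => //; first exact: measurable_funTS.
move=> x /=; rewrite !in_itv/= => /andP[sx xt].
by rewrite (le_trans bs sx) (le_lt_trans xt tl).
Qed.

(** Serves for [Num.max 0 s ^+ 2], whose kink at 0 needs no separate treatment in this form. *)
Lemma is_derive_quadratic (f : R -> R) (x d : R) :
  (forall h, `|f (h + x) - f x - h * d| <= h ^+ 2) -> is_derive x 1 f d.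
Proof.
move=> fd.
have cf : h^-1 *: ((f \o shift x) (h *: 1) - f x) @[h --> 0^'] --> d.
  apply/cvgrPdist_le => e e0; near=> h.
  have h0 : h != 0 by near: h; exact: nbhs_dnbhs_neq.
  have he : `|h| < e by near: h; exact: dnbhs0_lt.
  apply: le_trans (ltW he).
  rewrite /= /shift /= -[h *: 1]/(h * 1) mulr1 -[_ *: _]/(_ * _).
  have -> : d - h^-1 * (f (h + x) - f x) = - (h^-1 * (f (h + x) - f x - h * d)).
    by field.
  rewrite normrN normrM normfV ler_pdivrMl ?normr_gt0// -normrM -expr2.
  by rewrite (le_trans (fd h))// normrX real_normK// num_real.
split; first by apply/cvg_ex; exists d.
exact: cvg_lim.
Unshelve. all: by end_near. Qed.

(** On [[0, 1]] this is [1 - (1 - s ^+ 2) ^+ 2]. Both truncations are the C^1 function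
    [Num.max 0 s ^+ 2], so the chain rule yields a continuous derivative everywhere. *)
Definition smoothstep (s : R) : R :=
  1 - Num.max 0 (1 - Num.max 0 s ^+ 2) ^+ 2.

Definition dsmoothstep (s : R) : R :=
  4 * Num.max 0 (1 - Num.max 0 s ^+ 2) * Num.max 0 s.

Lemma is_derive_maxsqr (x : R) :
  is_derive x 1 (fun s : R => Num.max 0 s ^+ 2) (2 * Num.max 0 x).
Proof.
apply: is_derive_quadratic => h; rewrite ler_norml.
(* When [x] and [h + x] are both nonnegative, the error is exactly [h ^+ 2]. *)
by case: (leP 0 x) => ?; case: (leP 0 (h + x)) => ?; apply/andP; split; nra.
Qed.

Lemma is_derive_smoothstep (x : R) : is_derive x 1 smoothstep (dsmoothstep x).
Proof.
pose P (s : R) : R := Num.max 0 s ^+ 2.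
have dP (s : R) : is_derive s 1 P (2 * Num.max 0 s) by exact: is_derive_maxsqr.
have d1 (s : R) : is_derive s 1 (cst 1 - P) (0 - 2 * Num.max 0 s) by exact: is_deriveB.
have -> : smoothstep = cst 1 - (P \o (cst 1 - P)) by [].
have -> : dsmoothstep x = 0 - (2 * Num.max 0 ((cst 1 - P) x)) * (0 - 2 * Num.max 0 x).
  by rewrite /dsmoothstep sub0r sub0r mulrN opprK fctE/= /P; ring.
apply: is_deriveB; exact: is_derive1_comp.
Qed.

Lemma smoothstep0 s : s <= 0 -> smoothstep s = 0.
Proof. by move=> s0; rewrite /smoothstep (@max_l _ _ 0 s)// expr0n subr0 max_r// expr1n subrr. Qed.

Lemma smoothstep1 s : 1 <= s -> smoothstep s = 1.
Proof.
move=> s1; rewrite /smoothstep (@max_r _ _ 0 s) ?(le_trans ler01 s1)//.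
by rewrite max_l ?expr0n ?subr0// subr_le0 exprn_ege1.
Qed.

Lemma dsmoothstep_ge0 s : 0 <= dsmoothstep s.
Proof. by rewrite /dsmoothstep !mulr_ge0// le_max lexx. Qed.

(** The boolean factor records the support: it is what confines the energy of the truncated function
    to a single layer. *)
Lemma dsmoothstep_le s : dsmoothstep s <= 4 * (0 < s < 1)%R%:R.
Proof.
rewrite /dsmoothstep; have [s0|s0] := leP s 0; first by rewrite mulr0.
rewrite /=; have [s1|s1] := ltP s 1.
  have s2 : 0 <= 1 - s ^+ 2 by nra.
  rewrite max_r// -mulrA ler_pM2l// mulr_ile1 ?(ltW s0) ?(ltW s1)//.
  by rewrite gerBl sqr_ge0.
by rewrite max_l ?mulr0 ?mul0r// subr_le0 exprn_ege1.
Qed.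

Lemma continuous_dsmoothstep : continuous dsmoothstep.
Proof.
have cm : continuous (fun s : R => Num.max 0 s).
  by move=> s; apply: continuous_max; [exact: cst_continuous|exact: cvg_id].
have cm2 : continuous (fun s : R => Num.max 0 (1 - Num.max 0 s ^+ 2)).
  move=> s; apply: (@continuous_comp _ _ _ (fun s : R => 1 - Num.max 0 s ^+ 2)
    (fun s : R => Num.max 0 s));
    last exact: cm.
  apply: continuousB; first exact: cst_continuous.
  by apply: (@continuousM _ _ (fun s : R => Num.max 0 s) (fun s : R => Num.max 0 s)); exact: cm.
move=> s; apply: (@continuousM _ _
  (fun s : R => 4 * Num.max 0 (1 - Num.max 0 s ^+ 2)) (fun s : R => Num.max 0 s));
  last exact: cm.
by apply: continuousM; [exact: cst_continuous|exact: cm2].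
Qed.

End oscillation.

(** * An uncentered maximal function *)

Section maximal.
Context {R : realType}.

Lemma coord_le_enorm n (v : 'rV[R]_n) i : `|v 0 i| <= enorm v.
Proof.
rewrite -sqrtr_sqr; apply: ler_wsqrtr; rewrite (bigD1 i)//= lerDl.
by apply: sumr_ge0 => j _; exact: sqr_ge0.
Qed.

(** The squared length is below [n * d ^+ 2], hence below [(n * d) ^+ 2]; the crude factor [n]
    avoids a square root. *)
Lemma enorm_lt n (v : 'rV[R]_n) d :
  (0 < n)%N -> (forall i, `|v 0 i| < d) -> enorm v < n%:R * d.
Proof.
case: n v => // n v _ vd.
have d0 : 0 < d by exact: le_lt_trans (vd 0).
have nd0 : 0 < n.+1%:R * d by rewrite mulr_gt0.
rewrite -[ltRHS]ger0_norm ?ltW// -sqrtr_sqr ltr_sqrt ?exprn_gt0//.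
apply: (@lt_le_trans _ _ (\sum_(i < n.+1) d ^+ 2)).
  apply: ltr_sum => // [|i _].
    by apply/hasP; exists ord0 => //; rewrite mem_index_enum.
  by rewrite -real_normK ?num_real// ltr_pXn2r ?nnegrE// ltW.
rewrite sumr_const card_ord -[leLHS]mulr_natl exprMn.
apply: ler_wpM2r; first exact: sqr_ge0.
by rewrite ler_eXnr// ler1n.
Qed.

Lemma continuous_enorm (T : topologicalType) n (F : T -> 'rV[R]_n) :
  (forall i, continuous (fun x => F x 0 i)) -> continuous (fun x => enorm (F x)).
Proof.
move=> cF x; rewrite /enorm.
have cS (s : seq 'I_n) : continuous (fun x => \sum_(i <- s) F x 0 i ^+ 2).
  elim: s => [|i s IH] z.
    by under eq_fun do rewrite big_nil; exact: cst_continuous.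
  under eq_fun do rewrite big_cons.
  apply: (@continuousD _ _ _ (fun x => F x 0 i ^+ 2)); last exact: IH.
  by apply: (@continuousM _ _ (fun x => F x 0 i) (fun x => F x 0 i)); exact: cF.
apply: (@continuous_comp _ _ _ (fun x => \sum_i F x 0 i ^+ 2) Num.sqrt).
  exact: cS.
exact: sqrt_continuous.
Qed.

Lemma eball_open n (x : 'rV[R]_n) r : open (eball x r).
Proof.
rewrite (_ : eball x r = (fun y => enorm (y - x)) @^-1` [set t | t < r])//.
apply: open_comp; last exact: open_lt.
move=> y _; apply: continuous_enorm => i {}y; under eq_fun do rewrite !mxE.
by apply: continuousB; [exact: coord_continuous|exact: cst_continuous].
Qed.

Lemma measurable_open n (U : set 'rV[R]_n) :
  open U -> measurable (U : set (borel_rV R n)).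
Proof. exact: sub_sigma_algebra. Qed.

Variables (n : nat) (mu : {measure set (borel_rV R n) -> \bar R}).

(* [ball] is the ball of the sup norm, i.e. an open cube.  Uncentering makes the
   function lower semicontinuous, hence measurable; the factor makes it a
   minorant of [maximal1]. *)
Definition maximal_cube (x : 'rV[R]_n) : \bar R :=
  ereal_sup [set (((2 * n%:R * p.2) / (4 * n%:R * p.2) ^+ n)%:E * mu (ball p.1 p.2))%E |
    p in [set p : 'rV[R]_n * R | 0 < p.2 /\ ball p.1 p.2 x]].

Lemma maximal_cube_ge x y r : 0 < r -> ball y r x ->
  (((2 * n%:R * r) / (4 * n%:R * r) ^+ n)%:E * mu (ball y r) <= maximal_cube x)%E.
Proof. by move=> r0 yx; apply: ereal_sup_ubound; exists (y, r). Qed.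

Lemma maximal_cube_ge0 x : (0 <= maximal_cube x)%E.
Proof.
apply: le_trans (maximal_cube_ge ltr01 (ballxx x ltr01)).
by rewrite mule_ge0// lee_fin divr_ge0 ?exprn_ge0// !mulr_ge0.
Qed.

(** A ball that beats the level [r] at one of its points beats it at all of them, so superlevel sets
    are open. *)
Lemma measurable_maximal_cube :
  measurable_fun setT (maximal_cube : borel_rV R n -> \bar R).
Proof.
apply: (measurability _ (ErealGenOInfty.measurableE R)) => // _ [_ [r ->] <-].
rewrite setTI; apply: measurable_open.
rewrite openE => x /=; rewrite in_itv/= andbT => /ereal_sup_gt[_ [[y d] /= [d0 yx] <-] lt].
have := @ball_open _ _ y d; rewrite openE => /(_ _ yx); apply: filterS => z yz /=.
rewrite in_itv/= andbT; apply: lt_le_trans lt _; exact: maximal_cube_ge.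
Qed.

(** A sup-norm ball of radius [r] containing [x] lies in the Euclidean ball of radius [2 * n * r]
    about [x], which lies in a cube of side [4 * n * r]. The first inclusion compares the values of
    [mu], the second the volumes. *)
Lemma maximal_cube_le x : (0 < n)%N -> (maximal_cube x <= maximal1 mu x)%E.
Proof.
move=> n0; apply: ub_ereal_sup => _ [[y r] /= [r0 yx] <-].
have n0' : 0 < n%:R :> R by rewrite ltr0n.
set rho := 2 * n%:R * r.
have rho0 : 0 < rho by rewrite !mulr_gt0.
apply: (@le_trans _ _ (rho%:E * mu (eball x rho) / lebesgue_rV R n (eball x rho))%E); last first.
  by apply: ereal_sup_ubound; exists rho.
rewrite EFinM -muleA (muleC _ (mu _)) muleA.
have ox := measurable_open (@eball_open n x rho).
have oy := measurable_open (@ball_open _ _ y r).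
apply: lee_pmul.
- by rewrite mule_ge0// lee_fin ltW.
- by rewrite lee_fin invr_ge0 exprn_ge0// !mulr_ge0// ltW.
- apply: lee_wpmul2l; first by rewrite lee_fin ltW.
  apply: le_measure; rewrite ?inE// => z yz.
  rewrite /eball /=/rho mulrAC mulrC; apply: enorm_lt => // i.
  have [_ /(_ 0 i) yz'] := yz; have [_ /(_ 0 i) yx'] := yx.
  move: yz' yx'; rewrite /ball /= !mxE !ltr_norml => /andP[? ?] /andP[? ?].
  by apply/andP; split; lra.
- have : (lebesgue_rV R n (eball x rho) <= ((4 * n%:R * r) ^+ n)%:E)%E.
    have -> : 4 * n%:R * r = 2 * rho by rewrite /rho; ring.
    rewrite -(@lebesgue_cube _ _ (x - const_mx rho)); last first.
      by rewrite mulr_ge0// ltW.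
    apply: le_measure; rewrite ?inE//; first exact: measurable_cube.
    move=> z /= xz i; have := le_lt_trans (coord_le_enorm _ i) xz.
    by rewrite !mxE ltr_norml => /andP[? ?]; apply/andP; split; lra.
  have : (0 <= lebesgue_rV R n (eball x rho))%E by [].
  case: (lebesgue_rV R n (eball x rho)) => [v| |]//.
  (* The inverse of 0 is [+oo], so no positive lower bound on the volume of the ball is required. *)
  rewrite !lee_fin inver => v0 vle; have [_|vn0] := eqVneq v 0; first exact: leey.
  rewrite lee_fin lef_pV2// posrE; last by rewrite lt_neqAle eq_sym vn0.
  by rewrite exprn_gt0// !mulr_gt0.
Qed.

End maximal.

(** * Dyadic stopping time *)

Section stopping.
Context {R : realType}.

(** Serves both for the dyadic children of a cube and for the layers between levels of [u]. *)
Lemma ge0_integral_bigcup_fin d (T : measurableType d)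
    (mu : {measure set T -> \bar R}) (I : finType) (F : I -> set T)
    (f : T -> \bar R) :
  (forall i, measurable (F i)) -> trivIset setT F ->
  measurable_fun setT f -> (forall x, 0 <= f x)%E ->
  (\int[mu]_(x in \bigcup_i F i) f x = \sum_i \int[mu]_(x in F i) f x)%E.
Proof.
move=> mF tF mf f0.
have -> : \bigcup_i F i = \big[setU/set0]_(i <- index_enum I) F i.
  by rewrite -bigcup_seq; congr bigcup; apply/seteqP; split=> // i _; exact: mem_index_enum.
rewrite ge0_integral_bigsetU//; first exact: index_enum_uniq.
  by apply: sub_trivIset tF.
exact: measurable_funTS.
Qed.

(** Here [l] is the side of the child, half that of the parent; [b] chooses the lower or upper half
    in each coordinate. *)
Definition subcube_corner n (a : 'rV[R]_n) (l : R) (b : {ffun 'I_n -> bool}) :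
  'rV[R]_n := \row_i (a 0 i + l * (b i)%:R).

Lemma cube_split n (a : 'rV[R]_n) l : 0 < l ->
  \bigcup_b cube (subcube_corner a l b) l = cube a (2 * l).
Proof.
move=> l0; apply/seteqP; split => [x [b _ xb] i|x xa].
  have := xb i; rewrite !mxE.
  by case: (b i); rewrite ?mulr1 ?mulr0 => /andP[? ?]; apply/andP; split; lra.
exists [ffun i => a 0 i + l <= x 0 i] => // i; have /andP[? ?] := xa i.
by rewrite !mxE ffunE; have [?|?] := leP (a 0 i + l) (x 0 i);
  rewrite ?mulr1 ?mulr0; apply/andP; split; lra.
Qed.

Lemma trivIset_subcube n (a : 'rV[R]_n) l : 0 < l ->
  trivIset setT (fun b => cube (subcube_corner a l b) l).
Proof.
move=> l0 b c _ _ [x [xb xc]]; apply/ffunP => i.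
have := xb i; have := xc i; rewrite !mxE.
by case: (b i); case: (c i); rewrite ?mulr1 ?mulr0// => /andP[? ?] /andP[? ?]; lra.
Qed.

(** On the cube, [maximal_cube mu] is at least [k] times the [mu]-mass of the cube. Multiplying by
    [g] and integrating, the assumed lower bound on the integral of [g] absorbs [k]. *)
Lemma measure_le_poincare n (mu : {measure set (borel_rV R n) -> \bar R})
    (a : 'rV[R]_n) r (g : 'rV[R]_n -> R) :
  (0 < n)%N -> 0 < r -> continuous g -> (forall x, 0 <= g x) ->
  ((r ^+ n / 2 ^+ n.+1)%:E <=
    (n%:R * r)%:E * \int[lebesgue_rV R n]_(x in cube a r) (g x)%:E)%E ->
  (mu (cube a r) <= ((8 * n%:R) ^+ n)%:E *
    \int[lebesgue_rV R n]_(x in cube a r) ((g x)%:E * maximal_cube mu x))%E.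
Proof.
move=> n0 r0 cg g0 gr.
have n0' : 0 < n%:R :> R by rewrite ltr0n.
pose Q : set (borel_rV R n) := cube a r.
have mQ : measurable Q by exact: measurable_cube.
pose k : R := (2 * n%:R * r) / (4 * n%:R * r) ^+ n.
have k0 : 0 < k by rewrite divr_gt0// ?exprn_gt0// !mulr_gt0.
have mg : measurable_fun Q (fun x : borel_rV R n => (g x)%:E).
  by apply: measurable_funTS; exact: continuous_measurable_rVE.
have mw : measurable_fun Q (maximal_cube mu : borel_rV R n -> _).
  by apply: measurable_funTS; exact: measurable_maximal_cube.
have gE x : (0 <= (g x)%:E)%E by rewrite lee_fin.
apply: (@le_trans _ _ (((8 * n%:R) ^+ n)%:E *
    (\int[lebesgue_rV R n]_(x in cube a r) (g x)%:E * (k%:E * mu (cube a r))))%E);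
    last first.
  apply: lee_wpmul2l; first by rewrite lee_fin exprn_ge0// mulr_ge0// ltW.
  rewrite -ge0_integralZr//; last by rewrite mule_ge0// lee_fin ltW.
  apply: ge0_le_integral => //.
  - by move=> x _; rewrite mule_ge0// mule_ge0// lee_fin ltW.
  - by apply: emeasurable_funM => //; exact: measurable_cst.
  - exact: emeasurable_funM.
  - move=> x xa; apply: lee_wpmul2l => //.
    (* Radius [r], because the open ball of radius [r / 2] would miss the lower faces. *)
    have cb : cube a r `<=` ball (a + const_mx (r / 2)) r.
      move=> y ya; split=> // i j; rewrite (ord1 i) /ball/= !mxE.
      by have /andP[? ?] := ya j; rewrite ltr_norml; apply/andP; split; lra.
    apply: le_trans (maximal_cube_ge mu r0 (cb _ xa)).
    apply: lee_wpmul2l; first by rewrite lee_fin ltW.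
    by apply: le_measure; rewrite ?inE//; apply: measurable_open; exact: ball_open.
rewrite muleA muleA -[leLHS]mul1e; apply: lee_wpmul2r => //.
rewrite -muleA (muleC _ k%:E) muleA -EFinM.
(* The middle term equals 1, since [(8 * n) ^+ n * k / (n * r)] is [2 ^+ n.+1 / r ^+ n]; this fixes
   the constant. *)
apply: (@le_trans _ _ (((8 * n%:R) ^+ n * k / (n%:R * r))%:E *
  (r ^+ n / 2 ^+ n.+1)%:E)%E).
  rewrite -EFinM lee_fin /k !exprMn exprS.
  have -> : (8 : R) ^+ n = 4 ^+ n * 2 ^+ n by rewrite -exprMn; congr (_ ^+ _); ring.
  rewrite le_eqVlt; apply/orP; left; apply/eqP.
  by field; rewrite !expf_neq0 ?gt_eqF// !mulr_gt0.
rewrite [X in (_ <= X%:E * _)%E](_ : _ =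
    (8 * n%:R) ^+ n * k / (n%:R * r) * (n%:R * r)); last first.
  by rewrite divfK// gt_eqF// mulr_gt0.
rewrite [X in (_ <= X * _)%E]EFinM -[leRHS]muleA; apply: lee_wpmul2l => //.
by rewrite lee_fin ltW// divr_gt0// mulr_gt0// exprn_gt0// mulr_gt0.
Qed.

Lemma measurable_level n (v : 'rV[R]_n -> R) c :
  continuous v -> measurable ([set x | v x = c] : set (borel_rV R n)).
Proof.
move=> /continuous_measurable_rV mv; rewrite -[X in measurable X]setTI.
by have := mv measurableT _ (measurable_set1 c).
Qed.

Lemma measurable_two_levels n (v : 'rV[R]_n -> R) b c : continuous v ->
  measurable ([set x | v x != b /\ v x != c] : set (borel_rV R n)).
Proof.
move=> cv; rewrite (_ : mkset _ = ~` [set x | v x = b] `&` ~` [set x | v x = c]).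
  by apply: measurableI; apply: measurableC; exact: measurable_level.
by apply/seteqP; split=> x /= [/eqP ? /eqP ?]; split=> //; exact/eqP.
Qed.

(** The stopping time is run as an induction on the scale, for cubes less than half filled by
    [{v = 1}]. If all children are also less than half filled, their estimates add up; otherwise the
    cube is stopped and the Poincare estimate applies to it. *)
Lemma stopping_cubes n (mu : {measure set (borel_rV R n) -> \bar R})
    (v g : 'rV[R]_n -> R) (U : set (borel_rV R n)) (l0 : R) :
  (0 < n)%N -> 0 < l0 -> continuous v -> continuous g -> (forall x, 0 <= g x) ->
  (forall x i b l s t, b <= s < b + l -> b <= t < b + l ->
    (`|v (upd x i s) - v (upd x i t)|%R%:E <=
     \int[lebesgue_measure]_(r in `[b, (b + l)%R[) (g (upd x i r))%:E)%E) ->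
  measurable U ->
  (forall a x, cube a l0 x -> U x -> forall y, cube a l0 y -> v y = 1) ->
  (lebesgue_rV R n [set x | v x != 0%R /\ v x != 1%R] <= (l0 ^+ n / 4)%:E)%E ->
  forall k a, let l := 2 ^+ k * l0 in
  (lebesgue_rV R n (cube a l `&` [set x | v x = 1%R]) < (l ^+ n / 2)%:E)%E ->
  (mu (cube a l `&` U) <= ((8 * n%:R) ^+ n)%:E *
    \int[lebesgue_rV R n]_(x in cube a l) ((g x)%:E * maximal_cube mu x))%E.
Proof.
move=> n0 l00 cv cg g0 vg mU Ul0 LT.
set C := ((8 * n%:R) ^+ n)%:E.
have C0 : (0 <= C)%E by rewrite lee_fin exprn_ge0// mulr_ge0.
have mE c := measurable_level c cv.
pose W (x : borel_rV R n) := ((g x)%:E * maximal_cube mu x)%E.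
have mW : measurable_fun setT W.
  apply: emeasurable_funM; first exact: continuous_measurable_rVE.
  exact: measurable_maximal_cube.
have W0 x : (0 <= W x)%E by rewrite mule_ge0 ?maximal_cube_ge0// lee_fin.
have mQ := @measurable_cube R n.
elim=> [|k IH] a l.
  rewrite /l expr0 mul1r => h.
  (* At the smallest scale a cube that meets [U] lies in [{v = 1}], so a cube less than half filled
     misses [U]. *)
  have [[x [xa Ux]]|/nonemptyPn ->] := pselect (cube a l0 `&` U !=set0); last first.
    by rewrite measure0; apply: mule_ge0 => //; apply: integral_ge0 => x _; exact: W0.
  move: h; rewrite (_ : _ `&` _ = cube a l0); last first.
    apply/seteqP; split=> [y []//|y ya]; split=> //=; exact: Ul0 xa Ux _ ya.
  rewrite (lebesgue_cube _ (ltW l00)) lte_fin => h; exfalso.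
  by have := exprn_gt0 n l00; lra.
have -> : l = 2 * (2 ^+ k * l0) by rewrite /l exprS mulrA.
clear l.
(* From here on [l] is the side of the children; the cube itself has side [2 * l]. *)
set l := 2 ^+ k * l0 => LE.
have l_gt0 : 0 < l by rewrite mulr_gt0// exprn_gt0.
pose F b : set (borel_rV R n) := cube (subcube_corner a l b) l.
have [small|/existsNP[b /negP]] := pselect (forall b,
    (lebesgue_rV R n (F b `&` [set x | v x = 1%R]) < (l ^+ n / 2)%:E)%E).
  have mF b : measurable (F b) by exact: mQ.
  have tF : trivIset setT F by exact: trivIset_subcube.
  (* With the left side written as the integral of an indicator, both sides split over the children
     by the same lemma. *)
  rewrite setIC -integral_indic// -cube_split//.
  rewrite !(ge0_integral_bigcup_fin _ mF tF)//; last first.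
    by apply/measurable_EFinP; exact: measurable_indic.
  rewrite ge0_sume_distrr//; last first.
    by move=> b _; apply: integral_ge0 => x _; exact: W0.
  apply: lee_sum => b _; rewrite integral_indic// setIC.
  exact: IH (small b).
rewrite -leNgt => big.
have mQE : measurable ((cube a (2 * l) : set (borel_rV R n)) `&` [set x | v x = 1%R]).
  by apply: measurableI => //; exact: mQ.
have mQZ : measurable ((cube a (2 * l) : set (borel_rV R n)) `&` [set x | v x = 0%R]).
  by apply: measurableI => //; exact: mQ.
apply: (@le_trans _ _ (mu (cube a (2 * l)))).
  apply: le_measure; rewrite ?inE; last exact: subIsetl.
    by apply: measurableI => //; exact: mQ.
  exact: mQ.
apply: measure_le_poincare => //; first by rewrite mulr_gt0.
(* The volume required of each level set is half that of a child; for [{v = 1}] the child [b] alone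
   supplies it. *)
have -> : (2 * l) ^+ n / 2 ^+ n.+1 = l ^+ n / 2.
  by rewrite exprMn exprS; field; rewrite expf_neq0.
apply: (poincare_levels n0 _ cv cg g0 _ mQE mQZ) => //.
- by rewrite mulr_gt0.
- by move=> x i s t; exact: vg.
- by move=> x [].
- by move=> x [].
- by rewrite divr_ge0// exprn_ge0// ltW.
- apply: (le_trans big); apply: le_measure; rewrite ?inE//.
    by apply: measurableI => //; exact: mQ.
  apply: setSI; rewrite -(cube_split a l_gt0); exact: bigcup_sup.
(* With [L = (2 * l) ^+ n], the set [{v = 1}] takes less than [L / 2] and the transition zone at
   most [l0 ^+ n / 4 <= L / 4]; more than [L / 4] is left to [{v = 0}], and
   [L / 4 >= l ^+ n / 2]. *)
- have mT := measurable_two_levels 0 1 cv.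
  have cover : (lebesgue_rV R n (cube a (2 * l)) <=
      lebesgue_rV R n (cube a (2 * l) `&` [set x | v x = 1%R]) +
      (lebesgue_rV R n (cube a (2 * l) `&` [set x | v x = 0%R]) +
       lebesgue_rV R n [set x | v x != 0%R /\ v x != 1%R]))%E.
    apply: le_trans (leeD2l _ (measureU2 _ mQZ mT)).
    apply: le_trans (measureU2 _ mQE _); last exact: measurableU.
    apply: le_measure; rewrite ?inE//.
      by apply: measurableU => //; exact: measurableU.
    move=> x xa; have [v1|v1] := eqVneq (v x) 1; first by left.
    by right; have [v0|v0] := eqVneq (v x) 0; [left|right].
  move: cover LE LT; rewrite lebesgue_cube; last by rewrite mulr_ge0// ltW.
  have [h1 h2] : l ^+ n <= (2 * l) ^+ n / 2 /\ l0 ^+ n <= (2 * l) ^+ n.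
    have l0l : l0 <= 2 * l.
      by rewrite /l mulrA -exprS ler_peMl ?(ltW l00)// exprn_ege1// ler1n.
    have l2 : 0 <= 2 * l by rewrite mulr_ge0// ltW.
    split; last by apply: lerXn2r l0l; rewrite nnegrE// ltW.
    rewrite (exprMn _ 2) mulrAC; apply: ler_peMl; first by rewrite exprn_ge0// ltW.
    by rewrite ler_pdivlMr// mul1r ler_eXnr// ler1n.
  move: (lebesgue_rV R n (_ `&` [set x | v x = 1])) => x1.
  move: (lebesgue_rV R n (_ `&` [set x | v x = 0])) => x0.
  move: (lebesgue_rV R n _) => x2.
  case: x1 => [x1| |]//; case: x2 => [x2| |]//; case: x0 => [x0| |]//; rewrite ?leey//.
  rewrite -!EFinD !lee_fin lte_fin => ? ? ?; lra.
Qed.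

End stopping.

(** * Level sets *)

Section levels.
Context {R : realType}.

Lemma continuous_upd n (x : 'rV[R]_n) i : continuous (upd x i).
Proof.
move=> r A /nbhs_ballP[e /= e0 eA].
apply/nbhs_ballP; exists e => //= t rt; apply: eA; split=> // j k; rewrite !mxE.
by case: ifP => // _; exact: ballxx.
Qed.

(** The two difference quotients coincide as functions of the increment. *)
Lemma is_derive_upd n (u : 'rV[R]_n -> R) (x : 'rV[R]_n) i (r : R) :
  derivable u (upd x i r) (delta_mx 0 i) ->
  is_derive r 1 (fun t : R => u (upd x i t)) (partial i u (upd x i r)).
Proof.
move=> du.
have E : (fun h : R => h^-1 *: (((fun t : R => u (upd x i t)) \o shift r) (h *: 1)
      - u (upd x i r))) =
    (fun h => h^-1 *: ((u \o shift (upd x i r)) (h *: delta_mx 0 i) - u (upd x i r))).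
  apply/funext => h /=; congr (_ *: (u _ - _)); apply/rowP => j; rewrite !mxE eqxx/=.
  by case: eqP => _; rewrite ?mulr1 ?mulr0 ?add0r// -[h *: 1]/(h * 1) mulr1.
split; first by rewrite /derivable E.
by rewrite /derive E.
Qed.

Lemma continuous_grad n (u : 'rV[R]_n -> R) :
  smooth u -> continuous (fun x => enorm (grad u x)).
Proof.
move=> su; apply: continuous_enorm => i; under eq_fun do rewrite mxE.
by have [] := su [:: i].
Qed.

(** The chain rule along a coordinate line, with the partial derivative bounded by the full
    gradient. This is the line hypothesis of the stopping argument for the truncation of [u]. *)
Lemma smoothstep_increment n (u : 'rV[R]_n -> R) (t h : R) x i b l s r :
  smooth u -> 0 < h -> b <= s < b + l -> b <= r < b + l ->
  (`|smoothstep ((u (upd x i s) - t) / h) - smoothstep ((u (upd x i r) - t) / h)|%R%:E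
   <= \int[lebesgue_measure]_(q in `[b, (b + l)%R[)
     (dsmoothstep ((u (upd x i q) - t) / h) / h * enorm (grad u (upd x i q)))%:E)%E.
Proof.
move=> su h0; have [cu du] := su [::]; have [cp _] := su [:: i].
have cux : continuous (fun q => u (upd x i q)).
  by move=> q; apply: continuous_comp; [exact: continuous_upd|exact: cu].
have cphi : continuous (fun q => dsmoothstep ((u (upd x i q) - t) / h)).
  move=> q; apply: (@continuous_comp _ _ _ (fun q => (u (upd x i q) - t) / h)).
    apply: (@continuousM _ _ (fun q => u (upd x i q) - t)); last exact: cst_continuous.
    by apply: continuousB; [exact: cux|exact: cst_continuous].
  exact: continuous_dsmoothstep.
apply: (@increment_le_integral R (fun q => smoothstep ((u (upd x i q) - t) / h))
  (fun q => dsmoothstep ((u (upd x i q) - t) / h) * (partial i u (upd x i q) / h))).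
- move=> q.
  apply: (@is_derive1_comp _ smoothstep (fun q => (u (upd x i q) - t) / h)).
    exact: is_derive_smoothstep.
  rewrite (_ : (fun q => _) = h^-1 \*: ((fun q => u (upd x i q)) - cst t)); last first.
    by apply/funext => z /=; rewrite mulrC.
  rewrite -[X in is_derive _ _ _ X](_ : h^-1 *: (partial i u (upd x i q) - 0) = _); last first.
    by rewrite subr0 -[_ *: _]/(_ * _) mulrC.
  by apply: is_deriveZ; apply: is_deriveB; exact: is_derive_upd.
- move=> q; apply: (@continuousM _ _ (fun q => dsmoothstep ((u (upd x i q) - t) / h))).
    exact: cphi.
  apply: (@continuousM _ _ (fun q => partial i u (upd x i q))); last exact: cst_continuous.
  by apply: (@continuous_comp _ _ _ (upd x i)); [exact: continuous_upd|exact: cp].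
- move=> q; apply: (@continuousM _ _ (fun q => dsmoothstep ((u (upd x i q) - t) / h) / h)).
    apply: (@continuousM _ _ (fun q => dsmoothstep ((u (upd x i q) - t) / h))).
      exact: cphi.
    exact: cst_continuous.
  apply: (@continuous_comp _ _ _ (upd x i) (fun x => enorm (grad u x))).
    exact: continuous_upd.
  exact: continuous_grad.
- move=> q; rewrite mulrA mulrAC normrM ger0_norm; last first.
    by rewrite divr_ge0 ?dsmoothstep_ge0// ltW.
  apply: ler_wpM2l; first by rewrite divr_ge0 ?dsmoothstep_ge0// ltW.
  by apply: le_trans (coord_le_enorm _ i); rewrite mxE.
Qed.

(** The normalized shares [a k / A + b k / B] sum to at most 2, so they cannot all exceed
    [2 / N]. *)
Lemma pigeonhole2 N (a b : 'I_N -> R) (A B : R) :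
  0 < A -> 0 < B -> (0 < N)%N -> (forall k, 0 <= a k) -> (forall k, 0 <= b k) ->
  \sum_k a k <= A -> \sum_k b k <= B ->
  exists k, a k <= 2 * A / N%:R /\ b k <= 2 * B / N%:R.
Proof.
move=> A0 B0 N0 a0 b0 aA bB; apply: contrapT => /forallNP h.
have N0' : 0 < N%:R :> R by rewrite ltr0n.
have : \sum_(k < N) (2 / N%:R) < \sum_(k < N) (a k / A + b k / B).
  apply: ltr_sum.
    by apply/hasP; exists (Ordinal N0) => //; rewrite mem_index_enum.
  move=> k _; have [|] := ltP (2 * A / N%:R) (a k) => [ak|ak].
    by rewrite ltr_wpDr ?divr_ge0 ?(ltW B0)// ltr_pdivlMr// mulrAC.
  have [bk|bk] := ltP (2 * B / N%:R) (b k); last by case: (h k).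
  by rewrite ltr_wpDl ?divr_ge0 ?(ltW A0)// ltr_pdivlMr// mulrAC.
rewrite sumr_const card_ord -[ltLHS]mulr_natr divfK ?gt_eqF// big_split/=.
rewrite -!mulr_suml => lt.
have : (\sum_k a k) / A <= 1 by rewrite ler_pdivrMr// mul1r.
have : (\sum_k b k) / B <= 1 by rewrite ler_pdivrMr// mul1r.
by lra.
Qed.

(** Compactness of [{1 <= u}] makes the scale uniform. It provides the smallest cubes of the
    stopping time, and the gap down to [1 / 2] leaves room for the layers. *)
Lemma compact_superlevel n (u : 'rV[R]_n -> R) :
  continuous u -> compactly_supported u ->
  exists2 l0 : R, 0 < l0 &
    forall a x y, cube a l0 x -> cube a l0 y -> 1 <= u x -> 1 / 2 < u y.
Proof.
move=> cu su.
have cF : compact [set x | 1 <= u x].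
  apply: (subclosed_compact _ su).
    apply: (@closed_comp _ _ u [set r | 1 <= r]); last exact: closed_ge.
    by move=> x _; exact: cu.
  move=> x /= ux; apply: subset_closure => /=; rewrite gt_eqF//.
  exact: lt_le_trans ux.
move/compact_near_coveringP : cF => /(_ R (0^'+)%R
  (fun l x => forall y, ball x l y -> 1 / 2 < u y) _) h.
have {h} : \forall l \near 0^'+, [set x | 1 <= u x] `<=`
    (fun x => forall y, ball x l y -> 1 / 2 < u y).
  apply: h => x /= ux.
  have : nbhs (u x) [set r | 1 / 2 < r].
    by apply: open_nbhs_nbhs; split; [exact: open_gt|rewrite /=; lra].
  move=> /(cu x) /nbhs_ballP[e /= e0 eu].
  exists (ball x (e / 2), [set l | l < e / 2]) => /=.
    split; first by apply: nbhsx_ballx; rewrite divr_gt0.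
    by apply: nbhs_right_lt; rewrite divr_gt0.
  move=> [z l] /= [xz le] y zy; apply: eu.
  by apply: (le_ball _ (ball_triangle xz zy)); lra.
move=> H; near ((0 : R)^'+) => l.
have l0 : 0 < l by near: l; exact: nbhs_right_gt.
have Hl : [set x | 1 <= u x] `<=` (fun x => forall y, ball x l y -> 1 / 2 < u y).
  by near: l; exact: H.
exists l => // a x y xa ya /Hl; apply; split=> // i j; rewrite (ord1 i) /ball/=.
have /andP[? ?] := xa j; have /andP[? ?] := ya j.
by rewrite ltr_norml; apply/andP; split; lra.
Unshelve. all: by end_near. Qed.

End levels.

(** * The estimate for a single admissible function *)

Section estimate.
Context {R : realType}.

Lemma compactly_supported_cube n (u : 'rV[R]_n -> R) : compactly_supported u ->
  exists2 r : R, 0 < r & forall x, u x != 0 -> cube (const_mx (- r)) (2 * r) x.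
Proof.
move=> /compact_bounded[M [_ /(_ (`|M| + 1))]].
have M1 : M < `|M| + 1 by rewrite (le_lt_trans (ler_norm _))// ltrDl.
move=> /(_ M1) uM; exists (`|M| + 2); first by rewrite ltr_wpDl.
move=> x ux i; have : ball (0 : 'rV[R]_n) (`|M| + 2) x.
  rewrite -ball_normE /= sub0r normrN.
  by apply: (le_lt_trans (uM x _)); [exact: subset_closure|rewrite ltrD2l ltr1n].
move=> [_ /(_ 0 i)]; rewrite /ball /= !mxE ltr_norml => /andP[? ?].
by apply/andP; split; lra.
Qed.

Lemma measurable_superlevel n (u : 'rV[R]_n -> R) c : continuous u ->
  measurable ([set x | c <= u x] : set (borel_rV R n)).
Proof.
move=> /continuous_measurable_rV mu; rewrite -[X in measurable X]setTI.
have := mu measurableT `[c, +oo[%classic (measurable_itv _).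
by congr measurable; apply/seteqP; split => x /=; rewrite in_itv/= andbT.
Qed.

(** The number [N] of layers depends on [u], but the constant does not: the slope [4 / h] of the
    step times the share [2 / N] of the energy is 16, as [h = 1 / (2 * N)]. *)
Lemma superlevel_measure_le n (mu : {measure set (borel_rV R n) -> \bar R})
    (u : 'rV[R]_n -> R) (A : R) :
  (1 < n)%N -> smooth u -> compactly_supported u -> (forall x, 0 <= u x) -> 0 < A ->
  (\int[lebesgue_rV R n]_x ((enorm (grad u x))%:E * maximal_cube mu x) <= A%:E)%E ->
  (mu [set x | 1 <= u x]%R <= ((8 * n%:R) ^+ n)%:E * (16 * A)%:E)%E.
Proof.
move=> n1 su csu u0 A0 intA; have n0 : (0 < n)%N by exact: ltnW.
have [cu du] := su [::].
have [l0 l00 ul0] := compact_superlevel cu csu.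
have [r r0 ur] := compactly_supported_cube csu.
have mu_ := continuous_measurable_rV cu.
have mQ := @measurable_cube R n.
pose V : R := (2 * r) ^+ n.
have V0 : 0 < V by rewrite exprn_gt0// mulr_gt0.
(* So many layers that twice the average volume of a layer fits the transition zone allowed by
   [stopping_cubes]. *)
pose N := (Num.trunc (8 * V / l0 ^+ n)).+1.
have N0 : 0 < N%:R :> R by rewrite ltr0n.
have NV : 2 * V / N%:R <= l0 ^+ n / 4.
  have : 8 * V / l0 ^+ n < N%:R by exact: truncnS_gt.
  rewrite ltr_pdivrMr ?exprn_gt0// => h.
  by rewrite ler_pdivrMr// mulrAC ler_pdivlMr//; lra.
pose h : R := (2 * N%:R)^-1.
have h0 : 0 < h by rewrite invr_gt0 mulr_gt0.
(* Strict inequalities make the layers disjoint and keep even the lowest one inside [{u != 0}]. *)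
pose T (k : 'I_N) : set (borel_rV R n) := [set x | k%:R * h < u x < (k%:R + 1) * h].
have mT k : measurable (T k).
  rewrite -[X in measurable X]setTI.
  have := mu_ measurableT `]k%:R * h, (k%:R + 1) * h[%classic (measurable_itv _).
  by congr measurable; apply/seteqP; split => x /=; rewrite in_itv.
have tT : trivIset setT T.
  move=> i j _ _ [x [/andP[xi1 xi2] /andP[xj1 xj2]]]; apply/val_inj/eqP => /=.
  have ij : i%:R < j%:R + 1 :> R by rewrite -(ltr_pM2r h0) (lt_trans xi1).
  have ji : j%:R < i%:R + 1 :> R by rewrite -(ltr_pM2r h0) (lt_trans xj1).
  by move: ij ji; rewrite !natr1 !ltr_nat !ltnS eqn_leq => -> ->.
pose F (x : borel_rV R n) := ((enorm (grad u x))%:E * maximal_cube mu x)%E.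
have F0 x : (0 <= F x)%E.
  by rewrite mule_ge0 ?maximal_cube_ge0// lee_fin sqrtr_ge0.
have mF : measurable_fun setT F.
  apply: emeasurable_funM; last exact: measurable_maximal_cube.
  apply: continuous_measurable_rVE; exact: continuous_grad.
have intT0 k : (0 <= \int[lebesgue_rV R n]_(x in T k) F x)%E.
  by apply: integral_ge0 => x _; exact: F0.
have mBT : measurable (\bigcup_k T k).
  exact: fin_bigcup_measurable.
have sumF : (\sum_k \int[lebesgue_rV R n]_(x in T k) F x <= A%:E)%E.
  rewrite -(ge0_integral_bigcup_fin _ mT tT)//; apply: le_trans intA.
  exact: ge0_subset_integral.
have intTfin k : (\int[lebesgue_rV R n]_(x in T k) F x)%E \is a fin_num.
  rewrite ge0_fin_numE//; apply: le_lt_trans (ltry A); apply: le_trans sumF.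
  by rewrite (bigD1 k)//= leeDl// sume_ge0.
have sumT : (\sum_k lebesgue_rV R n (T k) <= V%:E)%E.
  rewrite (eq_bigr (fun k => \int[lebesgue_rV R n]_(x in T k) cst 1 x)%E); last first.
    by move=> k _; rewrite integral_cst// mul1e.
  rewrite -(ge0_integral_bigcup_fin _ mT tT)//.
  rewrite integral_cst ?mul1e//.
  rewrite -(@lebesgue_cube _ _ (const_mx (- r))); last by rewrite mulr_ge0// ltW.
  apply: le_measure; rewrite ?inE//.
  move=> x [k _ /andP[xk _]]; apply: ur; rewrite gt_eqF//.
  by apply: le_lt_trans xk; rewrite mulr_ge0// ltW.
have LTfin k : (lebesgue_rV R n (T k)) \is a fin_num.
  rewrite ge0_fin_numE//; apply: le_lt_trans (ltry V); apply: le_trans sumT.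
  by rewrite (bigD1 k)//= leeDl// sume_ge0.
have [k [kA kV]] : exists k,
    fine (\int[lebesgue_rV R n]_(x in T k) F x) <= 2 * A / N%:R /\
    fine (lebesgue_rV R n (T k)) <= 2 * V / N%:R.
  apply: pigeonhole2 => //; try by move=> k; exact: fine_ge0.
    rewrite -lee_fin -sumEFin; apply: le_trans sumF.
    by apply: lee_sum => k _; rewrite fineK.
  rewrite -lee_fin -sumEFin; apply: le_trans sumT.
  by apply: lee_sum => k _; rewrite fineK.
pose t : R := k%:R * h.
pose v x := smoothstep ((u x - t) / h).
pose g x := dsmoothstep ((u x - t) / h) / h * enorm (grad u x).
have t0 : 0 <= t by rewrite mulr_ge0// ltW.
(* Since [k + 1 <= N] and [N * h = 1 / 2]. *)
have th : t + h <= 1 / 2.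
  rewrite /t -[X in _ + X]mul1r -mulrDl /h invfM mulrA ler_pdivrMr// mul1r.
  rewrite ler_pdivrMr// mulrC mulrA divff// mul1r natr1 ler_nat.
  exact: ltn_ord.
have caff : continuous (fun x => (u x - t) / h).
  move=> x; apply: (@continuousM _ _ (fun x => u x - t)); last exact: cst_continuous.
  by apply: continuousB; [exact: cu|exact: cst_continuous].
have cv : continuous v.
  move=> x; apply: (@continuous_comp _ _ _ (fun x => (u x - t) / h) smoothstep).
    exact: caff.
  apply/differentiable_continuous/derivable1_diffP.
  by have [] := is_derive_smoothstep ((u x - t) / h).
have cg : continuous g.
  move=> x; apply: (@continuousM _ _ (fun x => dsmoothstep ((u x - t) / h) / h)).
    apply: (@continuousM _ _ (fun x => dsmoothstep ((u x - t) / h))).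
      apply: (@continuous_comp _ _ _ (fun x => (u x - t) / h) dsmoothstep).
        exact: caff.
      exact: continuous_dsmoothstep.
    exact: cst_continuous.
  exact: continuous_grad.
have g0 x : 0 <= g x.
  by rewrite mulr_ge0 ?sqrtr_ge0// divr_ge0 ?dsmoothstep_ge0// ltW.
have v1 x : t + h <= u x -> v x = 1.
  by move=> tu; apply: smoothstep1; rewrite ler_pdivlMr//; lra.
have v0 x : u x <= t -> v x = 0.
  by move=> tu; apply: smoothstep0; rewrite ler_pdivrMr//; lra.
have mU := measurable_superlevel 1 cu.
(* The starting cube has side above [4 * r], so [{v = 1}], confined to a cube of side [2 * r], fills
   less than half of it. *)
pose K := (Num.trunc (4 * r / l0)).+1.
pose l : R := 2 ^+ K * l0.
have rl : 4 * r < l.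
  rewrite -ltr_pdivrMr//; apply: lt_le_trans (truncnS_gt _) _.
  by rewrite -natrX ler_nat ltnW// ltn_expl.
have l_gt0 : 0 < l by rewrite mulr_gt0// exprn_gt0.
pose a : 'rV[R]_n := const_mx (- (l / 2)).
have ra : cube (const_mx (- r)) (2 * r) `<=` cube a l.
  move=> x xr i; have := xr i; rewrite !mxE => /andP[? ?].
  by apply/andP; split; lra.
have Ua : [set x | 1 <= u x] `<=` cube a l.
  by move=> x /= ux; apply/ra/ur; rewrite gt_eqF// (lt_le_trans _ ux).
have := @stopping_cubes R n mu v g [set x | 1 <= u x] l0 n0 l00 cv cg g0 _ mU _ _ K a _.
rewrite -/l (setIidr Ua) => stop.
apply: le_trans (stop _ _ _ _) _.
- move=> x i b l' s q; exact: smoothstep_increment.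
- move=> b x xb ux y yb; apply: v1; apply: (le_trans th); apply/ltW.
  exact: ul0 xb yb ux.
- apply: (@le_trans _ _ (lebesgue_rV R n (T k))).
    apply: le_measure; rewrite ?inE//; last first.
      move=> x /= [vx0 vx1]; apply/andP; split.
        by rewrite ltNge; apply: contra vx0 => /v0 ->.
      by rewrite mulrDl mul1r ltNge; apply: contra vx1 => /v1 ->.
    exact: measurable_two_levels.
  by rewrite -(fineK (LTfin k)) lee_fin (le_trans kV).
- apply: (@le_lt_trans _ _ (lebesgue_rV R n (cube (const_mx (- r)) (2 * r)))).
    apply: le_measure; rewrite ?inE//.
      by apply: measurableI; [exact: mQ|exact: measurable_level].
    move=> x [_ /= vx]; apply: ur; apply/negP => /eqP ux.
    by move: vx; rewrite v0 ?ux// => /esym/eqP; rewrite oner_eq0.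
  rewrite lebesgue_cube; last by rewrite mulr_ge0// ltW.
  rewrite lte_fin ltr_pdivlMr//; apply: (@le_lt_trans _ _ ((4 * r) ^+ n)).
    rewrite (_ : 4 * r = 2 * r * 2); last by ring.
    rewrite (exprMn _ (2 * r)); apply: ler_wpM2l.
      by rewrite exprn_ge0// mulr_ge0// ltW.
    by rewrite ler_eXnr// ler1n.
  by rewrite ltrXn2r ?nnegrE ?mulr_ge0// ?ltW// -lt0n.
apply: lee_wpmul2l; first by rewrite lee_fin exprn_ge0// mulr_ge0.
(* Off the layer [g] vanishes, and on it [g] is at most [4 / h] times the length of the gradient of
   [u]. *)
apply: (@le_trans _ _ (\int[lebesgue_rV R n]_(x in T k) ((4 / h)%:E * F x))%E).
  rewrite [leRHS]integral_mkcond.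
  have mF4 : measurable_fun setT (fun x : borel_rV R n => (4 / h)%:E * F x)%E.
    by apply: emeasurable_funM => //; exact: measurable_cst.
  have mFT := (measurable_restrictT _ (mT k)).1 (measurable_funTS mF4).
  have FT0 x : (0 <= ((fun x : borel_rV R n => (4 / h)%:E * F x)%E \_ (T k)) x)%E.
    rewrite patchE; case: ifP => // _; rewrite mule_ge0// lee_fin.
    by rewrite divr_ge0// ltW.
  apply: (@le_trans _ _ (\int[lebesgue_rV R n]_(x in cube a l)
    ((fun x : borel_rV R n => (4 / h)%:E * F x)%E \_ (T k)) x)%E); last first.
    by apply: ge0_subset_integral => //; exact: mQ.
  apply: ge0_le_integral => //.
  - by move=> x _; rewrite mule_ge0 ?maximal_cube_ge0// lee_fin.
  - apply: measurable_funTS; apply: emeasurable_funM; last exact: measurable_maximal_cube.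
    exact: continuous_measurable_rVE.
  - exact: measurable_funTS.
  - move=> x _; rewrite patchE /F muleA -EFinM.
    have gle := dsmoothstep_le ((u x - t) / h).
    case: ifPn => [_|xT].
      apply: lee_wpmul2r; rewrite ?maximal_cube_ge0// lee_fin /g.
      rewrite ler_wpM2r ?sqrtr_ge0// ler_wpM2r ?invr_ge0 ?(ltW h0)//.
      by apply: le_trans gle _; rewrite ler_piMr// lern1; case: (_ < _ < _).
    rewrite (_ : g x = 0) ?mul0e// /g.
    suff -> : dsmoothstep ((u x - t) / h) = 0 by rewrite !mul0r.
    apply/eqP; rewrite eq_le dsmoothstep_ge0 andbT (le_trans gle)//.
    case: (boolP (0 < _ < 1)) => [/andP[t1 t2]|]; last by rewrite mulr0.
    move: xT; rewrite notin_setE => /negP/= xT; exfalso; apply/(negP xT)/andP; split.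
      by move: t1; rewrite ltr_pdivlMr// mul0r subr_gt0.
    by move: t2; rewrite ltr_pdivrMr// mul1r mulrDl mul1r -/t; lra.
rewrite ge0_integralZl//; last 2 first.
- exact: measurable_funTS.
- by rewrite lee_fin divr_ge0// ltW.
rewrite -(fineK (intTfin k)) -EFinM lee_fin.
apply: (@le_trans _ _ (4 / h * (2 * A / N%:R))).
  by rewrite ler_wpM2l// divr_ge0// ltW.
rewrite /h invrK le_eqVlt; apply/orP; left; apply/eqP; field.
by rewrite gt_eqF.
Qed.

End estimate.

(* [maximal1] is compared with its measurable minorant [maximal_cube], without
   knowing that it is itself measurable. *)
Lemma ge0_le_integral_nonmeasurable d (T : measurableType d) (R : realType)
    (mu : {measure set T -> \bar R}) (f g : T -> \bar R) :
  (forall x, 0 <= f x)%E -> (forall x, f x <= g x)%E ->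
  (\int[mu]_x f x <= \int[mu]_x g x)%E.
Proof.
move=> f0 fg; rewrite !ge0_integralTE//; last by move=> x; exact: le_trans (fg x).
by apply: le_ereal_sup => _ [h hf <-]; exists h => // x; exact: le_trans (fg x).
Qed.

(** [mu_ext mu] gives a value to sets that need not be Borel. It is compared with [mu] on the Borel
    set [{1 <= u}], which contains [Omega] for every admissible [u]. *)
Theorem corollary2p7 (R : realType) (n : nat) (hn : (2 <= n)%N) :
  exists C : R, 0 < C /\
    forall mu : {measure set (borel_rV R n) -> \bar R},
      locally_finite mu ->
      forall Omega : set 'rV[R]_n,
        (mu_ext mu).-caratheodory Omega ->
        (mu_ext mu Omega <= C%:E * BVcap Omega (maximal1 mu))%E.
Proof.
have n0 : (0 < n)%N by exact: ltnW.
have C0 : 0 < (8 * n%:R) ^+ n * 16 :> R by rewrite mulr_gt0// exprn_gt0// mulr_gt0// ltr0n.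
exists ((8 * n%:R) ^+ n * 16); split=> // mu _ Omega _.
rewrite -lee_pdivrMl//; apply: le_ereal_inf_tmp => _ [u [su csu u0 [V [oV OV Vu]]] <-].
rewrite lee_pdivrMl//.
set J := (\int[_]_x _)%E.
have mU := measurable_superlevel 1 (su [::]).1.
have [J0 IJ] : (0 <= J /\ \int[lebesgue_rV R n]_x
    ((enorm (grad u x))%:E * maximal_cube mu x) <= J)%E.
  have F0 x : (0 <= (enorm (grad u x))%:E * maximal_cube mu x)%E.
    by rewrite mule_ge0 ?maximal_cube_ge0// lee_fin sqrtr_ge0.
  suff h : (\int[lebesgue_rV R n]_x
      ((enorm (grad u x))%:E * maximal_cube mu x) <= J)%E.
    by split=> //; apply: le_trans h; exact: integral_ge0.
  apply: ge0_le_integral_nonmeasurable => // x.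
  by apply: lee_wpmul2l; [rewrite lee_fin sqrtr_ge0|exact: maximal_cube_le].
apply: (@le_trans _ _ (mu [set x | 1 <= u x])).
  rewrite -(measurable_mu_extE mu mU); apply: le_mu_ext => x /OV; exact: Vu.
case: J J0 IJ => [A| |]// A0 IA; last by rewrite gt0_muley ?lte_fin ?leey.
(* The energy bound must be positive while [A] may be 0, so it is enlarged by [e] divided by the
   constant. *)
apply/lee_addgt0Pr => e e0.
rewrite lee_fin in A0.
apply: le_trans (superlevel_measure_le hn su csu u0 (_ : 0 < A + e / ((8 * n%:R) ^+ n * 16)) _) _.
- by rewrite ltr_wpDl// divr_gt0.
- by apply: (le_trans IA); rewrite lee_fin lerDl divr_ge0// ltW.
rewrite -!EFinM -EFinD lee_fin mulrA mulrDr.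
by rewrite (mulrC _ (e / _)) divfK// gt_eqF.
Qed.
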